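(* Let $\mathcal X\times\mathcal U\subseteq\mathbb R^n\times\mathbb R^m$ be a neighborhood of the origin and let $f:\mathcal X\times\mathcal U\to\mathbb R^n$ be continuous with $f(0,0)=0$. If the control system $\dot x=f(x,u)$ is locally asymptotically stabilizable by means of a composition operator with a continuous symbol, then $f$ is open at $(0,0)$.
   Context: $f$ is open at a point $\bar z$ if $f(\bar z)\in\operatorname{int} f(\mathcal V)$ for every neighborhood $\mathcal V$ of $\bar z$. For a neighborhood of the origin $\mathcal O\subseteq\mathcal X$ and a map $h:\mathcal O\to\mathcal X\times\mathcal U$, the composition operator $T_h$ with symbol $h$ is defined by $T_hf:=f\circ h$. The system $\dot x=f(x,u)$ is locally asymptotically stabilizable by means of a composition operator $T_h$ if there are such an $\mathcal O$ and $h$ for which the origin is a locally asymptotically stable equilibrium of $\dot x=T_hf(x)$. Standing assumption (uniqueness criterion): a stabilizing composition operator $T_h$ is always required to be such that $T_hf$ is continuous and $\dot x=T_hf(x)$ has a unique solution $x(t)$ for all $t\ge0$ and all initial states $x_0$ in a neighborhood of the origin.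
   Formalization: The symbol h is additionally required to satisfy h(0) = (0,0); without this the claim fails, e.g. f(x,u) = u²(u−1) with h(x) = (x, 1−x) on the plane. *)

(* Defs.v *)
From mathcomp Require Import all_boot all_order all_algebra.
From mathcomp Require Import all_classical all_reals all_analysis.
Import Order.TTheory GRing.Theory Num.Theory.
Import numFieldNormedType.Exports.
Set Implicit Arguments.
Unset Strict Implicit.
Unset Printing Implicit Defensive.
Local Open Scope classical_set_scope.
Local Open Scope ring_scope.

(* A map g : D -> T defined on a subset D of S is a total function on S of    *)
(* which only the values on D are ever used.                                  *)

Definition open_at (S T : topologicalType) (D : set S) (g : S -> T) (z : S)
    : Prop :=
  forall V : set S, nbhs z V -> (g @` (V `&` D))° (g z).

Definition composition_operator (A B C : Type) (h : A -> B) (f : B -> C)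
    : A -> C := f \o h.

Definition symbol (R : realType) (n m : nat)
    (X : set 'rV[R]_n) (U : set 'rV[R]_m) (D : set 'rV[R]_n)
    (h : 'rV[R]_n -> 'rV[R]_n * 'rV[R]_m) : Prop :=
  [/\ nbhs (0 : 'rV[R]_n) D, D `<=` X & forall x, D x -> (X `*` U) (h x)].

(* Solutions live on [0, +oo[ and remain in the domain D of F; the derivative *)
(* at t = 0 is one-sided, so that x t for t < 0 plays no role.                *)
Definition solution (R : realType) (n : nat) (D : set 'rV[R]_n)
    (F : 'rV[R]_n -> 'rV[R]_n) (x0 : 'rV[R]_n) (x : R -> 'rV[R]_n) : Prop :=
  [/\ x 0 = x0,
      forall t : R, 0 <= t -> D (x t),
      s^-1 *: (x s - x 0) @[s --> 0^'+] --> F (x 0)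
    & forall t : R, 0 < t -> is_derive t 1 x (F (x t))].

Definition uniqueness_criterion (R : realType) (n : nat) (D : set 'rV[R]_n)
    (F : 'rV[R]_n -> 'rV[R]_n) : Prop :=
  {within D, continuous F} /\
  \forall x0 \near (0 : 'rV[R]_n),
    (exists x, solution D F x0 x) /\
    (forall x y, solution D F x0 x -> solution D F x0 y ->
       forall t : R, 0 <= t -> x t = y t).

Definition lyapunov_stable (R : realType) (n : nat) (D : set 'rV[R]_n)
    (F : 'rV[R]_n -> 'rV[R]_n) : Prop :=
  forall e : R, 0 < e -> exists2 d : R, 0 < d &
    forall x0 x, `|x0| < d -> solution D F x0 x ->
      forall t : R, 0 <= t -> `|x t| < e.

Definition locally_attractive (R : realType) (n : nat) (D : set 'rV[R]_n)
    (F : 'rV[R]_n -> 'rV[R]_n) : Prop :=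
  exists2 d : R, 0 < d &
    forall x0 x, `|x0| < d -> solution D F x0 x ->
      x t @[t --> +oo] --> (0 : 'rV[R]_n).

Definition locally_asymptotically_stable (R : realType) (n : nat)
    (D : set 'rV[R]_n) (F : 'rV[R]_n -> 'rV[R]_n) : Prop :=
  [/\ F 0 = 0, lyapunov_stable D F & locally_attractive D F].

(* The condition h 0 = 0 says that the symbol maps the equilibrium state to   *)
(* the equilibrium (0, 0) of the control system. It is not implied by         *)
(* f (h 0) = 0: for f (x, u) = u ^+ 2 * (u - 1) and h x = (x, 1 - x) on the   *)
(* plane, the origin is asymptotically stable for f \o h, but f <= 0 near     *)
(* (0, 0), so openness at (0, 0) fails without it.                            *)
Definition stabilizable_by_continuous_symbol (R : realType) (n m : nat)
    (X : set 'rV[R]_n) (U : set 'rV[R]_m)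
    (f : 'rV[R]_n * 'rV[R]_m -> 'rV[R]_n) : Prop :=
  exists (D : set 'rV[R]_n) (h : 'rV[R]_n -> 'rV[R]_n * 'rV[R]_m),
    [/\ symbol X U D h,
        h 0 = (0, 0),
        {within D, continuous h},
        uniqueness_criterion D (composition_operator h f)
      & locally_asymptotically_stable D (composition_operator h f)].

(* Main.v *)
Require Import Defs.
From mathcomp Require Import all_boot all_order all_algebra.
From mathcomp Require Import all_classical all_reals all_analysis.
From mathcomp Require Import ring lra.
Set Implicit Arguments.
Unset Strict Implicit.
Unset Printing Implicit Defensive.
Import Order.TTheory GRing.Theory Num.Theory.
Import numFieldNormedType.Exports.
Local Open Scope ring_scope.

(** The closed-loop field F = f \o h is a continuous field with unique solutions
    and an asymptotically stable equilibrium at the origin, so the theorem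
    follows from Brockett's condition for such an F ([brockett]): F maps every
    neighborhood of 0 onto a neighborhood of F 0. Since h is continuous with
    h 0 = (0, 0), the values of F near 0 are values of f near (0, 0).

    Brockett's condition is a degree argument. Let phi be the flow and let r be
    small. By stability and compactness some time T carries the ball of radius r
    into the ball of radius r / 2 ([uniform_time]). The chords
    (phi x t - x) / t interpolate, for 0 <= t <= T, between F x (at t = 0) and
    (phi x T - x) / T. A chord based at a point x != 0 of the ball is never
    zero, as that would make x an equilibrium or a periodic point, while
    phi x t tends to 0. Hence on the sphere F is homotopic, without zeros, to a
    field that points inwards, and its degree is that of - x.

    No degree theory is used. The homotopy is spread over the shell
    r <= |z| <= 2 r: [chord] equals F on the inner ball and, at radius |z| > r,
    is the chord of duration proportional to |z| - r based at the radial
    projection of z. It is one continuous field on the ball of radius 2 r,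
    bounded away from 0 on the shell, and on the outer boundary it points
    inwards. As the norm on row vectors is the sup norm, balls are cubes, so the
    Poincare-Miranda theorem gives, for every small y, a zero of y - chord. This
    zero cannot lie in the shell, hence it is a solution of F x = y in the inner
    ball ([flow_covers]).

    Two facts are needed on the way. Poincare-Miranda comes from Kuhn's cubical
    lemma ([kuhn_cube]), proved by a discrete Stokes formula with coefficients
    mod 2. Continuity of the flow ([flow_dependence]) comes from uniqueness of
    solutions and Tychonoff's theorem, because being a solution can be written
    as a family of closed conditions on finitely many values of a trajectory. *)

(** * A discrete Stokes formula mod 2 and Kuhn's cubical lemma *)

Definition lattice_point n := 'I_n -> nat.
Definition corner {n} (p : lattice_point n) (B : {set 'I_n}) :
    lattice_point n :=
  fun i => (p i + (i \in B))%N.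
Definition fdiff {n} (j : 'I_n) (f : lattice_point n -> bool)
    (p : lattice_point n) : bool :=
  f (corner p [set j]) + f p.

(** The cup product dl_0 \cup ... \cup dl_(d-1) with coefficients mod 2, summed
    over the monotone edge paths from p to the opposite vertex of the cube
    spanned by A: the discrete counterpart of integrating the differential form
    dl_0 /\ ... /\ dl_(d-1) over this cube. The type bool is used as the field
    with two elements, which makes all signs disappear. It is meant for
    d = #|A|. *)
Fixpoint wedge {n} (l : nat -> lattice_point n -> bool) (d : nat)
    (A : {set 'I_n}) (p : lattice_point n) : bool :=
  if d is d'.+1 then
    \sum_(j in A) wedge l d' (A :\ j) p * fdiff j (l d') (corner p (A :\ j))
  else 1.

Lemma fdiffE {n} j (f : lattice_point n -> bool) p :
  fdiff j f p = f (corner p [set j]) + f p.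
Proof. by []. Qed.

Lemma wedgeS {n} (l : nat -> lattice_point n -> bool) d (A : {set 'I_n}) p :
  wedge l d.+1 A p =
  \sum_(j in A) wedge l d (A :\ j) p * fdiff j (l d) (corner p (A :\ j)).
Proof. by []. Qed.

Lemma cornerC {n} (p : lattice_point n) (B C : {set 'I_n}) :
  corner (corner p B) C = corner (corner p C) B.
Proof. by apply/funext => i; rewrite /corner addnAC. Qed.

Lemma corner1D {n} (p : lattice_point n) (j : 'I_n) (A : {set 'I_n}) :
  j \in A -> corner (corner p [set j]) (A :\ j) = corner p A.
Proof.
move=> jA; apply/funext => i; rewrite /corner !inE -addnA; congr addn.
by have [->|] := eqVneq i j; rewrite ?jA.
Qed.

(** The pairs (i, j) and (j, i) contribute twice the same value, and the
    coefficients are mod 2. *)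
Lemma sum_sym_offdiag {n} (A : {set 'I_n}) (g : 'I_n -> 'I_n -> bool) :
  (forall i j, g i j = g j i) ->
  \sum_(i in A) \sum_(j in A :\ i) g i j = 0.
Proof.
move=> gC; under eq_bigr => i iA.
  rewrite (bigID (fun j : 'I_n => (j < i)%N))/=; over.
rewrite big_split/=.
rewrite [X in X + _](exchange_big_dep (mem A))/=; last first.
  by move=> i j _; rewrite !inE -andbA => /and3P[].
set a := (X in X + _); set b := (X in _ + X); suff -> : a = b by exact: addbb.
apply: eq_bigr => j jA; rewrite (eq_bigr (fun i => g j i))//.
apply: eq_bigl => i; rewrite !inE jA -!val_eqE/=.
by case: (ltngtP i j) => _; rewrite /= ?andbF ?andbT.
Qed.

(** The discrete form of d (dl_0 /\ ... /\ dl_(d-1)) = 0. The discrete Leibniz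
    rule yields the same sum one dimension lower, plus second differences,
    which are symmetric and cancel in pairs. *)
Lemma wedge_closed {n} (l : nat -> lattice_point n -> bool) d (A : {set 'I_n}) p :
  \sum_(j in A) fdiff j (wedge l d (A :\ j)) p = 0.
Proof.
elim: d A p => [|d IH] A p; first by rewrite big1// => j _; exact: addbb.
have E j : j \in A -> fdiff j (wedge l d.+1 (A :\ j)) p =
  \sum_(m in A :\ j) fdiff j (wedge l d (A :\ m :\ j)) p
      * fdiff m (l d) (corner p (A :\ m))
  + \sum_(m in A :\ j) wedge l d (A :\ j :\ m) p *
      fdiff j (fdiff m (l d)) (corner p (A :\ j :\ m)).
  move=> jA; rewrite !fdiffE /= -!big_split/=; apply: eq_bigr => m.
  rewrite !inE => /andP[mj mA].
  have -> : A :\ m :\ j = A :\ j :\ m by rewrite !finset.setDDl finset.setUC.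
  have jm : j \in A :\ m by rewrite !inE eq_sym mj.
  have <- : corner (corner p [set j]) (A :\ j :\ m) = corner p (A :\ m).
    by rewrite -[in RHS](corner1D p jm) !finset.setDDl finset.setUC.
  rewrite !(fdiffE j) (cornerC _ (A :\ j :\ m)).
  set w := wedge _ _ _ _; set w' := wedge _ _ _ _.
  set a := fdiff _ _ _; set b := fdiff _ _ _.
  by case: w w' a b => [] [] [] [].
rewrite (eq_bigr _ E) big_split/=.
rewrite (exchange_big_dep (mem A))/=; last first.
  by move=> i j _; rewrite !inE => /andP[].
rewrite [X in X + _]big1 => [|m mA]; last first.
  rewrite -mulr_suml (eq_bigl (mem (A :\ m))) ?IH ?mul0r// => j.
  by rewrite !inE mA andbT eq_sym andbC.
rewrite add0r; apply: sum_sym_offdiag => i j.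
have -> : A :\ i :\ j = A :\ j :\ i by rewrite !finset.setDDl finset.setUC.
rewrite !fdiffE (cornerC _ [set i]); set w := wedge _ _ _ _.
set a := l _ _; set b := l _ _; set c := l _ _; set e := l _ _.
by case: w a b c e => [] [] [] [] [].
Qed.

(** The discrete form of
    dl_0 /\ ... /\ dl_d = d (l_d dl_0 /\ ... /\ dl_(d-1)): the two sides differ
    by the value of l_d at the far corner times the sum in [wedge_closed]. *)
Lemma wedge_exact {n} (l : nat -> lattice_point n -> bool) d (A : {set 'I_n}) p :
  wedge l d.+1 A p =
  \sum_(j in A) fdiff j (fun q => wedge l d (A :\ j) q * l d (corner q (A :\ j))) p.
Proof.
transitivity (wedge l d.+1 A p +
    (\sum_(j in A) fdiff j (wedge l d (A :\ j)) p) * l d (corner p A)).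
  by rewrite wedge_closed mul0r addr0.
rewrite wedgeS mulr_suml -big_split/=; apply: eq_bigr => j jA.
rewrite !(fdiffE j) (corner1D _ jA) cornerC (corner1D _ jA).
set w := wedge _ _ _ _; set w' := wedge _ _ _ _.
set a := l _ _; set b := l _ _.
by case: w w' a b => [] [] [] [].
Qed.

(** A form containing the factor dl_j restricts to 0 on a hyperplane on which
    l_j is constant. *)
Lemma wedge_face {n} (l : nat -> lattice_point n -> bool) d (A : {set 'I_n}) p
    (j : 'I_n) (c : bool) :
  (j < d)%N -> j \notin A -> (forall q, q j = p j -> l j q = c) ->
  wedge l d A p = 0.
Proof.
move=> + + lj; elim: d A => // d IH A; rewrite ltnS leq_eqVlt => jd jA /=.
apply: big1 => m mA; have mj : j != m by apply: contraNneq jA => ->.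
have jAm : j \notin A :\ m by rewrite inE (negPf jA) andbF.
case/orP: jd => [/eqP <-|jd]; last by rewrite IH ?mul0r.
have E (B : {set 'I_n}) (q : lattice_point n) : j \notin B -> corner q B j = q j.
  by rewrite /corner => /negPf ->; rewrite addn0.
rewrite fdiffE !lj ?E ?inE ?mj//.
by rewrite [c + c]addbb mulr0.
Qed.

(** Some path has all its factors nonzero, and each nonzero factor is a change
    of label along an edge of the cube. *)
Lemma wedge_neq0 {n} (l : nat -> lattice_point n -> bool) d (A : {set 'I_n}) p i :
  wedge l d A p -> (i < d)%N ->
  exists B C, l i (corner p B) /\ ~~ l i (corner p C).
Proof.
elim: d A => // d IH A W; rewrite ltnS leq_eqVlt.
have [j jA] : exists2 j, j \in A &
    wedge l d (A :\ j) p * fdiff j (l d) (corner p (A :\ j)).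
  apply/exists_inP; apply: contraTT W => /exists_inPn W /=.
  by rewrite big1// => j jA; apply/negbTE/W.
case/andP => Wj dj /orP[/eqP ->|]; last exact: IH Wj.
move: dj; rewrite !fdiffE cornerC (corner1D _ jA).
case E1 : (l d (corner p A)); case E2 : (l d (corner p (A :\ j))) => // _.
  by exists A, (A :\ j); rewrite E1 E2.
by exists (A :\ j), A; rewrite E1 E2.
Qed.

Definition setc {n} (p : lattice_point n) (j : 'I_n) t : lattice_point n :=
  fun i => if i == j then t else p i.

(** The discrete integral over the box [0, k)^s; the coordinates outside s are
    those of p. Iterating one-dimensional sums makes Stokes' formula a matter of
    telescoping in one coordinate. *)
Fixpoint box_sum {n} k (s : seq 'I_n) (f : lattice_point n -> bool)
    (p : lattice_point n) : bool :=
  if s is j :: s' then \sum_(0 <= t < k) box_sum k s' f (setc p j t) else f p.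

Lemma box_sum_sum {n} k (s : seq 'I_n) (A : {set 'I_n})
    (F : 'I_n -> lattice_point n -> bool) p :
  box_sum k s (fun q => \sum_(j in A) F j q) p =
  \sum_(j in A) box_sum k s (F j) p.
Proof.
elim: s p => //= a s IH p; rewrite exchange_big/=.
by apply: eq_bigr => t _; exact: IH.
Qed.

Lemma box_sum_ext {n} k (s : seq 'I_n) (f g : lattice_point n -> bool) p :
  (forall q, (forall i, i \notin s -> q i = p i) -> f q = g q) ->
  box_sum k s f p = box_sum k s g p.
Proof.
elim: s p => [|a s IH] p fg /=; first exact: fg.
apply: eq_bigr => t _; apply: IH => q qp; apply: fg => i.
by rewrite inE negb_or => /andP[/negPf ia /qp ->]; rewrite /setc ia.
Qed.

Lemma box_sum0 {n} k (s : seq 'I_n) p : box_sum k s (fun=> 0) p = 0.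
Proof. by elim: s p => //= a s IH p; rewrite big1. Qed.

Lemma box_sum_fdiff_out {n} k (s : seq 'I_n) j f p : j \notin s ->
  box_sum k s (fdiff j f) p = fdiff j (box_sum k s f) p.
Proof.
elim: s p => //= a s IH p; rewrite inE negb_or => /andP[ja js].
rewrite !fdiffE -big_split/=; apply: eq_bigr => t _.
rewrite IH// !fdiffE; congr (box_sum _ _ _ _ + _).
apply/funext => i; rewrite /corner /setc !inE.
by have [->|] := eqVneq i a; rewrite // [a == j]eq_sym (negPf ja) addn0.
Qed.

Lemma box_sum_fdiff {n} k (s : seq 'I_n) j f p : j \notin s ->
  box_sum k (j :: s) (fdiff j f) p =
  box_sum k s f (setc p j k) + box_sum k s f (setc p j 0).
Proof.
move=> js /=.
under eq_bigr => t _ do rewrite box_sum_fdiff_out//.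
have E t : corner (setc p j t) [set j] = setc p j t.+1.
  apply/funext => i; rewrite /corner /setc inE.
  by case: eqP => _; rewrite ?addn1 ?addn0.
under eq_bigr => t _ do rewrite fdiffE E.
elim: k (box_sum k s f) => [|k IH] F.
  by rewrite big_geq//; symmetry; exact: addbb.
rewrite big_nat_recr//= IH.
by case: (F _) (F _) (F _) => [] [] [].
Qed.

Lemma box_sum_fdiff0 {n} k (s : seq 'I_n) j f p : uniq s -> j \in s ->
  (forall q, q j = 0%N \/ q j = k -> f q = 0) -> box_sum k s (fdiff j f) p = 0.
Proof.
move=> + + f0; elim: s p => // a s IH p /= /andP[aNs us].
rewrite inE => /orP[/eqP ja|js]; last by rewrite big1// => t _; apply: IH.
have vanish q : q j = 0%N \/ q j = k -> box_sum k s f q = 0.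
  move=> qj; rewrite -[RHS](box_sum0 k s q); apply: box_sum_ext => q' q'q.
  by apply: f0; rewrite q'q ?ja// -ja.
rewrite -ja in aNs *; rewrite -[LHS]/(box_sum k (j :: s) (fdiff j f) p).
by rewrite box_sum_fdiff// !vanish /setc ?eqxx; [exact: addbb|left|right].
Qed.

Lemma box_sum_witness {n} k (s : seq 'I_n) (f : lattice_point n -> bool) p :
  box_sum k s f p -> exists q, [/\ f q, forall i, i \in s -> (q i < k)%N &
    forall i, i \notin s -> q i = p i].
Proof.
elim: s p => [|a s IH] p /=; first by exists p.
rewrite big_mkord => S.
have [t /IH[q [fq qk qp]]] : exists t : 'I_k, box_sum k s f (setc p a t).
  apply/existsP; apply: contraTT S => /existsPn S.
  by rewrite big1// => t _; apply/negbTE/S.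
exists q; split=> // i; rewrite inE; last first.
  by rewrite negb_or => /andP[ia /qp ->]; rewrite /setc (negPf ia).
case: (boolP (i \in s)) => [/qk//|/qp ->].
by rewrite orbF /setc => ->.
Qed.

(** Kuhn's cubical lemma, in the role that Sperner's lemma has for simplices.
    The form dl_0 /\ ... /\ dl_(n-1) has integral 1 over the box, so it is
    nonzero on some unit cube, where every label must change. *)
Lemma kuhn_cube {n} k (l : 'I_n -> lattice_point n -> bool) :
  (forall i p, p i = 0%N -> l i p = false) ->
  (forall i p, p i = k -> l i p = true) ->
  exists p, (forall i, (p i < k)%N) /\
    forall i, exists B C, l i (corner p B) /\ ~~ l i (corner p C).
Proof.
move=> l0 lk.
(* [wedge] takes labels indexed by nat; L extends l by 0. *)
pose L d p := if insub d is Some i then l i p else false.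
have LE (i : 'I_n) p : L i p = l i p by rewrite /L valK.
pose A d : {set 'I_n} := [set i : 'I_n | (i < d)%N]%SET.
have [s [us sE sE']] : exists s, [/\ uniq s, (forall i : 'I_n, i \in s) &
    box_sum k s (wedge L n (A n)) (fun=> k) = 1].
  (* Induction on d: the integral over the d-dimensional face on which the
     coordinates of index at least d are equal to k is 1. *)
  suff H d : (d <= n)%N -> exists s, [/\ uniq s,
      (forall i : 'I_n, i \in s = (i < d)%N) &
      box_sum k s (wedge L d (A d)) (fun=> k) = 1].
    have [s [us sE H1]] := H _ (leqnn n).
    by exists s; split=> // i; rewrite sE.
  elim: d => [|d IH] dn; first by exists [::].
  have [s [us sE H1]] := IH (ltnW dn).
  pose i0 := Ordinal dn.
  have i0s : i0 \notin s by rewrite sE ltnn.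
  exists (i0 :: s); split; first by rewrite /= i0s us.
    move=> i; rewrite inE sE ltnS [RHS]leq_eqVlt; exact: erefl.
  have Ai0 : A d.+1 :\ i0 = A d.
    by apply/setP => i; rewrite !inE ltnS -val_eqE /= ltn_neqAle.
  rewrite (_ : wedge L d.+1 (A d.+1) = fun p => \sum_(j in A d.+1)
    fdiff j (fun q => wedge L d (A d.+1 :\ j) q * L d (corner q (A d.+1 :\ j))) p);
    last by apply/funext => p; exact: wedge_exact.
  (* In the Stokes sum for dimension d + 1, both boundary terms in a direction
     j < d vanish because l_j is constant there; in the direction d, the term at
     0 vanishes because l_d = 0 there, and the term at k, where l_d = 1, is the
     integral of dimension d. *)
  rewrite box_sum_sum (bigD1 i0) ?inE// -[LHS]/(_ + _).
  rewrite [X in _ + X]big1 => [|j]; last first.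
    rewrite inE -val_eqE/= ltnS => /andP[jd ji0].
    have {}jd : (j < d)%N by rewrite ltn_neqAle ji0.
    apply: (@box_sum_fdiff0 _ k (i0 :: s)) => /=.
    - by rewrite i0s us.
    - by rewrite inE sE jd orbT.
    - have w0 c q : q j = c -> (forall q', q' j = c -> l j q' = (c == k)) ->
          wedge L d (A d.+1 :\ j) q = 0.
        move=> qj lc; apply: (@wedge_face _ L d _ q j (c == k)) => //.
          by rewrite !inE eqxx.
        by move=> q'; rewrite qj LE; exact: lc.
      have kgt0 : (0 < k)%N.
        case: posnP => // k0; have := l0 i0 (fun=> 0%N) erefl.
        by rewrite lk ?k0.
      move=> q [] /w0 ->; rewrite ?mul0r// => q' q'j.
        by rewrite l0// ltn_eqF.
      by rewrite lk// eqxx.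
  have Li0 p (b : bool) : (forall q, q i0 = p i0 -> l i0 q = b) ->
      L d (corner p (A d)) = b.
    by move=> lp; rewrite (LE i0); apply: lp; rewrite /corner inE ltnn addn0.
  have out q c : (forall i, i \notin s -> q i = setc (fun=> k) i0 c i) -> q i0 = c.
    by move=> -> //; rewrite /setc eqxx.
  rewrite addr0 Ai0 box_sum_fdiff// -[RHS]addr0; congr (_ (+) _).
    have -> : setc (fun=> k) i0 k = (fun=> k).
      by apply/funext => i; rewrite /setc; case: ifP.
    rewrite -[RHS]H1; apply: box_sum_ext => q /(_ i0 i0s) qi0.
    by rewrite (Li0 q true) ?mulr1// => q'; rewrite qi0; exact: lk.
  rewrite -[RHS](box_sum0 k s (setc (fun=> k) i0 0)).
  apply: box_sum_ext => q /out qi0.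
  by rewrite (Li0 q false) ?mulr0// => q'; rewrite qi0; exact: l0.
have [q [W qk _]] : exists q, [/\ wedge L n (A n) q,
    forall i, i \in s -> (q i < k)%N & forall i, i \notin s -> q i = k].
  by apply: box_sum_witness; rewrite sE'.
exists q; split=> [i|i]; first exact: qk.
by have [B [C]] := wedge_neq0 W (ltn_ord i); rewrite !LE; exists B, C.
Qed.

(** * The Poincare-Miranda theorem *)

Local Open Scope classical_set_scope.
Local Open Scope ring_scope.

Lemma continuous_epsP (R : realType) (V W : normedModType R) (f : V -> W) x :
  {for x, continuous f} <->
  forall e, 0 < e -> exists2 d, 0 < d & forall y, `|y - x| < d -> `|f y - f x| < e.
Proof.
split=> [/cvgrPdist_lt fx e /fx /nbhs_ballP[d /= d0 dP]|fx].
  by exists d => // y yx; rewrite distrC; apply: dP; rewrite -ball_normE/= distrC.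
apply/cvgrPdist_lt => e /fx[d d0 dP]; apply/nbhs_ballP; exists d => //= y.
by rewrite -ball_normE/= distrC => /dP; rewrite distrC.
Qed.

Lemma nbhs_norm_lt (R : realType) (V : normedModType R) (x : V) d : 0 < d ->
  nbhs x [set y | `|y - x| < d].
Proof.
move=> d0; apply/nbhs_ballP; exists d => //= y.
by rewrite -ball_normE/= distrC.
Qed.

(** Local uniformity along a filter F becomes uniformity on a compact set. All
    the compactness arguments below are instances, for F = 0^'+, +oo, or the
    neighborhoods of a point. *)
Lemma compact_near_uniform (X : topologicalType) (K : set X) (I : Type)
    (F : set_system I) (P : I -> X -> Prop) : Filter F -> compact K ->
  (forall x, K x -> exists A B, [/\ nbhs x A, F B &
     forall x' i, K x' -> A x' -> B i -> P i x']) ->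
  \forall i \near F, forall x, K x -> P i x.
Proof.
move=> FF /compact_near_coveringP/near_covering_withinP cK KP.
apply: (cK _ F P FF) => x /KP[A [B [xA FB AB]]].
by exists (A, B) => // -[x' i] [/= Ax' Bi] Kx'; exact: AB.
Qed.

Lemma rV_norm_le (R : realType) n (x : 'rV[R]_n) c : 0 <= c ->
  (`|x| <= c) <-> (forall i, `|x ord0 i| <= c).
Proof.
move=> c0; rewrite -[`|x|]/(mx_norm x) mx_normrE; split.
  by move=> /bigmax_leP[_ H] i; exact: (H (ord0, i)).
by move=> H; apply/bigmax_leP; split=> //= -[i j] _ /=; rewrite ord1.
Qed.

Lemma rV_norm_coord (R : realType) n (x : 'rV[R]_n) i : `|x ord0 i| <= `|x|.
Proof. exact: (rV_norm_le x (normr_ge0 x)).1. Qed.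

Definition cball (R : realType) n (r : R) : set 'rV[R]_n := [set x | `|x| <= r].

Lemma cball_compact (R : realType) n (r : R) : compact (@cball R n r).
Proof.
apply: bounded_closed_compact.
  by exists r; split; [exact: num_real|move=> s rs x /le_trans; apply; exact: ltW].
apply: (closed_comp _ (@closed_le _ r)) => x _; exact: norm_continuous.
Qed.

(** Kuhn's lemma on a fine grid, the label of a grid point being the sign of
    each coordinate of g. *)
Lemma almost_zero_in_cube (R : realType) n (a : R) (g : 'rV[R]_n -> 'rV[R]_n) :
  0 < a ->
  (forall x i, cball a x -> x ord0 i = - a -> g x ord0 i <= 0) ->
  (forall x i, cball a x -> x ord0 i = a -> 0 <= g x ord0 i) ->
  forall e, 0 < e -> exists x, cball a x /\ forall i,
    exists u v, [/\ `|u - x| < e, `|v - x| < e, g u ord0 i <= 0 & 0 <= g v ord0 i].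
Proof.
move=> a0 gle gge e e0.
have [k ke] : exists k, 2 * a / k.+1%:R < e.
  exists (Num.truncn (2 * a / e)).
  rewrite ltr_pdivrMr// [e * _]mulrC -ltr_pdivrMr//.
  by rewrite truncnS_gt.
pose N := k.+1.
(* Capping p i at N keeps every lattice point in the cube, as the labels have
   to be meaningful on all of them. *)
pose pt (p : lattice_point n) : 'rV[R]_n :=
  \row_i (2 * a / N%:R * (minn (p i) N)%:R - a).
have ptE p i : pt p ord0 i = 2 * a / N%:R * (minn (p i) N)%:R - a by rewrite mxE.
have N0 : (0 : R) < N%:R by rewrite ltr0n.
have h0 : 0 < 2 * a / N%:R by rewrite divr_gt0// mulr_gt0.
have hN : 2 * a / N%:R * N%:R = 2 * a by rewrite divfK// gt_eqF.
have pt_cube p : cball a (pt p).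
  apply/rV_norm_le; first exact: ltW.
  move=> i; rewrite ptE; set t := _ * _.
  have t0 : 0 <= t by rewrite mulr_ge0// ltW.
  have t1 : t <= 2 * a by rewrite -hN ler_pM2l// ler_nat geq_minr.
  by rewrite ler_norml; apply/andP; split; lra.
(* With weak inequalities on the faces the sign of g may vanish there, so the
   label 0 is imposed on the face p i = 0. *)
pose l i p := (p i != 0)%N && (0 <= g (pt p) ord0 i).
have l0 i p : p i = 0%N -> l i p = false by rewrite /l => ->.
have lN i p : p i = N -> l i p = true.
  by move=> pi; rewrite /l pi/= gge// ptE pi minnn hN; lra.
have [p [pN pP]] := kuhn_cube l0 lN.
have close B : `|pt (corner p B) - pt p| < e.
  apply: le_lt_trans ke; apply/rV_norm_le; first exact: ltW.
  move=> i; rewrite !mxE -/N.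
  rewrite (minn_idPl (ltnW (pN i))) (minn_idPl _); last first.
    by rewrite /corner; case: (i \in B); rewrite ?addn1 ?addn0// ltnW.
  rewrite /corner natrD mulrDr.
  set t := _ * _; set s := _ * _%:R.
  have -> : t + s - a - (t - a) = s by lra.
  by rewrite /s; case: (i \in B); rewrite ?mulr1 ?mulr0 ?normr0 ?gtr0_norm//; exact: ltW.
exists (pt p); split=> // i; have [B [C [lB lC]]] := pP i.
exists (pt (corner p C)), (pt (corner p B)); split=> //.
  move: lC; rewrite negb_and negbK => /orP[/eqP Ci|]; last first.
    by rewrite -ltNge => /ltW.
  by apply: gle => //; rewrite ptE Ci min0n mulr0 sub0r.
by case/andP: lB.
Qed.

(** A coordinate of g that is nonzero at x keeps its sign near x, which excludes
    almost zeros close to x; by compactness there would be none at all. *)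
Lemma poincare_miranda (R : realType) n (a : R) (g : 'rV[R]_n -> 'rV[R]_n) :
  0 < a -> continuous g ->
  (forall x i, cball a x -> x ord0 i = - a -> g x ord0 i <= 0) ->
  (forall x i, cball a x -> x ord0 i = a -> 0 <= g x ord0 i) ->
  exists x, cball a x /\ g x = 0.
Proof.
move=> a0 gcont gle gge; apply: contrapT => /forallNP no0.
pose near0 (e : R) x := forall i, exists u v,
  [/\ `|u - x| < e, `|v - x| < e, g u ord0 i <= 0 & 0 <= g v ord0 i].
suff: \forall e \near (0 : R)^'+, forall x, cball a x -> ~ near0 e x.
  move=> H; have [e [/= e0 eP]] := filter_ex (filterI (nbhs_right_gt (0 : R)) H).
  have [x [xa xe]] := almost_zero_in_cube a0 gle gge e0.
  exact: eP xa xe.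
apply: compact_near_uniform; first exact: cball_compact.
move=> x xa.
have [i gi] : exists i, g x ord0 i != 0.
  apply: contrapT => /forallNP gx; case: (no0 x); split=> //.
  by apply/rowP => i; rewrite mxE; have /negP := gx i; rewrite negbK => /eqP.
have [d d0 dP] : exists2 d, 0 < d & forall y, `|y - x| < d ->
    `|g y ord0 i - g x ord0 i| < `|g x ord0 i|.
  have [|d d0 dP] := (continuous_epsP g x).1 (gcont x) `|g x ord0 i|.
    by rewrite normr_gt0.
  exists d => // y /dP; apply: le_lt_trans.
  by have := rV_norm_coord (g y - g x) i; rewrite !mxE.
exists [set y | `|y - x| < d / 2], [set e | e < d / 2]; split.
- by apply: nbhs_norm_lt; rewrite divr_gt0.
- by apply: nbhs_right_lt; rewrite divr_gt0.
move=> y e _ /= yx ed /(_ i)[u [v [uy vy gu gv]]].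
have close w : `|w - y| < e -> `|w - x| < d.
  move=> wy; rewrite -(subrKA y) (le_lt_trans (ler_normD _ _))//.
  by rewrite [d]splitr ltrD// (lt_trans wy).
have := dP _ (close _ uy); have := dP _ (close _ vy).
have [gx|gx] := ltrP 0 (g x ord0 i).
  by rewrite (gtr0_norm gx) !ltr_norml => _ /andP[+ _]; lra.
by rewrite (ler0_norm gx) !ltr_norml => /andP[_ +] _; lra.
Qed.

(** * Estimates for solutions *)

Lemma is_derive_coord (R : realType) n (x : R -> 'rV[R]_n) (t : R) l i :
  is_derive t 1 x l -> is_derive t 1 (fun s => x s ord0 i) (l ord0 i).
Proof.
move=> xl; have dx : derivable x t 1 by [].
have := (derivable_mxP x t 1).1 dx ord0 i => dxi.
apply: DeriveDef => //.
by have /matrixP/(_ ord0 i) := derive_mx dx; rewrite derive_val mxE => ->.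
Qed.

(** At t = 0 only a one-sided difference quotient is available. *)
Lemma solution_right_continuous0 (R : realType) n D F (x0 : 'rV[R]_n) x :
  solution D F x0 x -> x s @[s --> 0^'+] --> x 0.
Proof.
move=> [_ _ x0' _].
have : s *: (s^-1 *: (x s - x 0)) + x 0 @[s --> 0^'+] --> 0 *: F (x 0) + x 0.
  apply: cvgD; last exact: cvg_cst.
  apply: cvgZ => //; apply: cvg_at_right_filter; exact: cvg_id.
rewrite scale0r add0r; apply: cvg_trans; apply: near_eq_cvg.
near=> s; rewrite scalerA divff ?scale1r ?subrK// gt_eqF//.
Unshelve. all: by end_near.
Qed.

Lemma solution_mvt (R : realType) n D F (x0 : 'rV[R]_n) x i t t' :
  solution D F x0 x -> 0 <= t -> t < t' ->
  exists2 s, s \in `]t, t'[ & x t' ord0 i - x t ord0 i = F (x s) ord0 i * (t' - t).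
Proof.
move=> xs t0 tt'; have [_ _ _ xd] := xs.
have xic s : 0 < s -> {for s, continuous (fun s => x s ord0 i)}.
  move=> s0; apply: differentiable_continuous; apply/derivable1_diffP.
  by have := is_derive_coord i (xd s s0).
apply: (@MVT R (fun s => x s ord0 i) (fun s => F (x s) ord0 i)) => //.
  move=> s; rewrite in_itv/= => /andP[ts _].
  exact: is_derive_coord (xd s (le_lt_trans t0 ts)).
apply/continuous_within_itvP => //; split.
- by move=> s; rewrite in_itv/= => /andP[ts _]; apply: xic; exact: le_lt_trans ts.
- have [->|t1] := eqVneq t 0; last first.
    by apply: cvg_at_right_filter; apply: xic; rewrite lt_neqAle eq_sym t1.
  apply: (@cvg_comp _ _ _ x (fun y : 'rV_n => y ord0 i)).
    exact: solution_right_continuous0 xs.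
  exact: coord_continuous.
- by apply: cvg_at_left_filter; apply: xic; exact: le_lt_trans tt'.
Qed.

Lemma cball_unif_continuous (R : realType) n (F : 'rV[R]_n -> 'rV[R]_n) r :
  continuous F -> forall e, 0 < e -> exists2 d, 0 < d & forall x y,
    cball r x -> cball r y -> `|y - x| < d -> `|F y - F x| < e.
Proof.
move=> Fc e e0.
suff H : \forall d \near (0 : R)^'+, forall x, cball r x ->
    forall y, cball r y -> `|y - x| < d -> `|F y - F x| < e.
  have [d [d0 dP]] := filter_ex (filterI (nbhs_right_gt (0 : R)) H).
  by exists d => // x y xr yr; exact: dP.
apply: compact_near_uniform; first exact: cball_compact.
move=> x xr; have [|d d0 dP] := (continuous_epsP F x).1 (Fc x) (e / 2).
  by rewrite divr_gt0.
exists [set y | `|y - x| < d / 2], [set e | e < d / 2]; split.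
- by apply: nbhs_norm_lt; rewrite divr_gt0.
- by apply: nbhs_right_lt; rewrite divr_gt0.
move=> x' c xr' /= x'x cd y yr yx'.
rewrite -(subrKA (F x)) (le_lt_trans (ler_normD _ _))// [e]splitr ltrD ?dP//.
  rewrite -(subrKA x') (le_lt_trans (ler_normD _ _))// [d]splitr ltrD//.
  exact: lt_trans cd.
rewrite distrC dP// (lt_le_trans x'x)// ler_pdivrMr//; lra.
Qed.

Lemma cball_bounded (R : realType) n (F : 'rV[R]_n -> 'rV[R]_n) r :
  continuous F -> exists2 M, 0 < M & forall x, cball r x -> `|F x| <= M.
Proof.
move=> Fc.
suff H : \forall M \near +oo, forall x, cball r x -> `|F x| <= M.
  have [M [M0 MP]] :=
    filter_ex (filterI (nbhs_pinfty_gt (num_real (0 : R))) H).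
  by exists M.
apply: compact_near_uniform; first exact: cball_compact.
move=> x xr; have [d d0 dP] := (continuous_epsP F x).1 (Fc x) 1 ltr01.
exists [set y | `|y - x| < d], [set M | `|F x| + 1 <= M]; split.
- exact: nbhs_norm_lt.
- by apply: nbhs_pinfty_ge; exact: num_real.
move=> y M _ /= /dP yx; apply: le_trans; rewrite -[F y](subrK (F x)) addrC.
by rewrite (le_trans (ler_normD _ _))// lerD2l ltW.
Qed.

Lemma solution_lipschitz (R : realType) n (F : 'rV[R]_n -> 'rV[R]_n) r :
  continuous F -> exists2 M, 0 < M & forall x0 x, solution (cball r) F x0 x ->
    forall t t', 0 <= t -> 0 <= t' -> `|x t' - x t| <= M * `|t' - t|.
Proof.
move=> /cball_bounded-/(_ r)[M M0 MP]; exists M => // x0 x xs t t'.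
wlog tt' : t t' / t < t' => [H t0 t'0|t0 t'0].
  have [tt'|t't|->] := ltgtP t t'; first exact: H.
  - by rewrite distrC [`|t' - t|]distrC; exact: H.
  - by rewrite !subrr !normr0 mulr0.
apply/rV_norm_le; first by rewrite mulr_ge0// ltW.
move=> i; rewrite !mxE; have [s] := solution_mvt i xs t0 tt'.
rewrite in_itv/= => /andP[ts _] ->; rewrite normrM ler_wpM2r//.
apply: (le_trans (rV_norm_coord _ _)); apply: MP.
by have [_ + _ _] := xs; apply; exact: le_trans (ltW ts).
Qed.

(** The mean value theorem turns the differential equation into conditions that
    are closed under pointwise limits, with a modulus d that is common to all
    solutions in the ball. *)
Lemma solution_estimate (R : realType) n (F : 'rV[R]_n -> 'rV[R]_n) r :
  continuous F -> forall e, 0 < e -> exists2 d, 0 < d & forall x0 x,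
    solution (cball r) F x0 x ->
    forall t t', 0 <= t -> 0 <= t' -> `|t' - t| < d ->
      `|x t' - x t - (t' - t) *: F (x t)| <= e * `|t' - t|.
Proof.
move=> Fc e e0; have [M M0 MP] := solution_lipschitz r Fc.
have [d d0 dP] := cball_unif_continuous r Fc e0.
exists (d / M); first by rewrite divr_gt0.
move=> x0 x xs t t' t0 t'0; rewrite ltr_pdivlMr// => td.
have [_ xr _ _] := xs.
have close s : 0 <= s -> `|s - t| <= `|t' - t| -> `|F (x s) - F (x t)| <= e.
  move=> s0 st; apply/ltW/dP; [exact: xr|exact: xr|].
  apply: le_lt_trans (MP _ _ xs _ _ t0 s0) _.
  by apply: le_lt_trans td; rewrite mulrC ler_wpM2r// ltW.
apply/rV_norm_le; first by rewrite mulr_ge0// ltW.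
move=> i; rewrite !mxE.
suff [s [s0 st ->]] : exists s, [/\ 0 <= s, `|s - t| <= `|t' - t| &
    x t' ord0 i - x t ord0 i = F (x s) ord0 i * (t' - t)].
  rewrite [(t' - t) * _]mulrC -mulrBl normrM ler_wpM2r//.
  apply: le_trans (close _ s0 st).
  by have := rV_norm_coord (F (x s) - F (x t)) i; rewrite !mxE.
have [tt'|t't|->] := ltgtP t t'.
- have [s] := solution_mvt i xs t0 tt'; rewrite in_itv/= => /andP[ts st'] H.
  exists s; split=> //; first exact: le_trans (ltW ts).
  by rewrite !gtr0_norm ?subr_gt0// lerD2r ltW.
- have [s] := solution_mvt i xs t'0 t't; rewrite in_itv/= => /andP[ts st'] H.
  exists s; split=> //; first exact: le_trans (ltW ts).
  + by rewrite !ltr0_norm ?subr_lt0// !opprB lerD2l lerN2 ltW.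
  + by rewrite -opprB H -mulrN opprB.
- by exists t'; rewrite !subrr mulr0.
Qed.

(** Converse to [solution_estimate]: after division by t' - t the estimates bound
    the distance between a difference quotient and F (x t). *)
Lemma estimate_solution (R : realType) n (F : 'rV[R]_n -> 'rV[R]_n) D x :
  (forall t, 0 <= t -> D (x t)) ->
  (forall e, 0 < e -> exists2 d, 0 < d &
    forall t t', 0 <= t -> 0 <= t' -> `|t' - t| < d ->
      `|x t' - x t - (t' - t) *: F (x t)| <= e * `|t' - t|) ->
  solution D F (x 0) x.
Proof.
move=> xD xe.
have quot t e : 0 <= t -> 0 < e -> exists2 d, 0 < d & forall h, h != 0 ->
    0 <= h + t -> `|h| < d -> `|F (x t) - h^-1 *: (x (h + t) - x t)| <= e.
  move=> t0 /xe[d d0 dP]; exists d => // h h0 ht hd.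
  have := dP t (h + t) t0 ht; rewrite addrK => /(_ hd).
  rewrite -ler_pdivrMr ?normr_gt0// => H; apply: le_trans H.
  rewrite -normfV mulrC -normrZ [in leRHS]scalerBr scalerA mulVf//.
  by rewrite scale1r distrC.
split=> //.
  apply/cvgrPdist_le => e e0; have [d d0 dP] := quot 0 e (lexx _) e0.
  near=> s; have := dP s; rewrite addr0; apply.
  - by rewrite gt_eqF//; near: s; exact: nbhs_right_gt.
  - by rewrite ltW//; near: s; exact: nbhs_right_gt.
  - rewrite gtr0_norm; first by near: s; exact: nbhs_right_lt.
    by near: s; exact: nbhs_right_gt.
move=> t t0.
have H : h^-1 *: ((x \o shift t) (h *: 1) - x t) @[h --> 0^'] --> F (x t).
  apply/cvgrPdist_le => e e0; have [d d0 dP] := quot t e (ltW t0) e0.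
  near=> h; rewrite /= [h *: 1]mulr1; apply: dP.
  - by near: h; exact: nbhs_dnbhs_neq.
  - rewrite -lerBlDr sub0r.
    have : `|h| < t by near: h; apply: dnbhs0_lt.
    by rewrite ltr_norml => /andP[/ltW].
  - by near: h; apply: dnbhs0_lt.
apply: DeriveDef; last exact: cvg_lim H.
by apply/cvg_ex; exists (F (x t)).
Unshelve. all: by end_near.
Qed.

(** Uniqueness is asserted for t >= 0 only, as a solution has arbitrary values at
    negative times. *)
Definition flow_on (R : realType) n (D : set 'rV[R]_n) F (K : set 'rV[R]_n)
    (phi : 'rV[R]_n -> R -> 'rV[R]_n) :=
  forall x, K x -> solution D F x (phi x) /\
    forall y, solution D F x y -> forall t, 0 <= t -> y t = phi x t.

(** Continuous dependence on the initial state, from uniqueness. The functions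
    of time with values in the ball form a compact space V for the product
    topology. An element f of V that is not the trajectory of x for t >= 0
    violates one of the closed conditions that characterize it, namely the initial value or an estimate of
    [solution_estimate]; by openness so do the elements of V close to f, which
    are therefore not the trajectory of any x' close to x. *)
Lemma flow_dependence (R : realType) n (F : 'rV[R]_n -> 'rV[R]_n) r K phi :
  continuous F -> flow_on (cball r) F K phi ->
  forall x t, K x -> 0 <= t -> forall e, 0 < e -> exists2 d, 0 < d &
    forall x', K x' -> `|x' - x| < d -> `|phi x' t - phi x t| < e.
Proof.
move=> Fc phiP x t Kx t0 e e0.
pose T : topologicalType := prod_topology (fun _ : R => 'rV[R]_n).
pose V : set T := [set f | forall s, cball r (f s)].
have Vc : compact V.
  exact: (@tychonoff R (fun=> 'rV[R]_n) (fun=> cball r) (fun=> @cball_compact R n r)).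
(* The absolute value discards the arbitrary values at negative times. *)
pose psi x' : T := fun s => phi x' `|s|.
pose P x' (f : T) := f = psi x' -> `|f t - phi x t| < e.
have projc s (f : T) : g s @[g --> f] --> f s.
  exact: (@proj_continuous _ (fun _ : R => 'rV[R]_n)).
suff : \forall x' \near within K (nbhs x), forall f, V f -> P x' f.
  rewrite /within /= => /nbhs_ballP[d /= d0 dP]; exists d => // x' Kx' x'x.
  have := dP x'; rewrite -ball_normE /= distrC => /(_ x'x Kx' (psi x')).
  rewrite /P /psi ger0_norm//; apply => // s.
  by have [[_ H _ _] _] := phiP _ Kx'; exact: H.
apply: compact_near_uniform => // f Vf.
pose est (g : R -> 'rV[R]_n) c d := forall t t', 0 <= t -> 0 <= t' -> `|t' - t| < d ->
  `|g t' - g t - (t' - t) *: F (g t)| <= c * `|t' - t|.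
have [f0|/eqP f0] := pselect (f 0 = x); last first.
  have d0 : 0 < `|f 0 - x| / 2 by rewrite divr_gt0// normr_gt0 subr_eq0.
  exists [set g | `|g 0 - f 0| < `|f 0 - x| / 2].
  exists [set x' | K x' /\ `|x' - x| < `|f 0 - x| / 2]; split.
  - exact: projc 0 f _ (nbhs_norm_lt (f 0) d0).
  - by apply: filterS (nbhs_norm_lt x d0) => x' x'x Kx'; split.
  move=> g x' _ /= + [Kx' x'x] gx'; rewrite gx' /psi normr0.
  have [[-> _ _ _] _] := phiP _ Kx' => x'f0; exfalso; move: x'x x'f0.
  have := ler_distD x' (f 0) x.
  rewrite [`|f 0 - x'|]distrC; lra.
have [fe|] := pselect (forall c, 0 < c -> exists2 d, 0 < d & est f c d).
  have [_ fx] := phiP _ Kx.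
  have fsol : solution (cball r) F x f.
    by rewrite -f0; apply: estimate_solution fe => s _; exact: Vf.
  exists [set g | `|g t - phi x t| < e], setT.
  split; [|exact: filterT|by move=> g x' _ /= ? _ _].
  by rewrite -(fx _ fsol _ t0); exact: projc t f _ (nbhs_norm_lt (f t) e0).
move=> /existsNP[c /not_implyP[c0 fc]].
have [d d0 dP] := solution_estimate r Fc c0.
have [s [s' [s0 s'0 s's fss']]] : exists s s', [/\ 0 <= s, 0 <= s', `|s' - s| < d &
     c * `|s' - s| < `|f s' - f s - (s' - s) *: F (f s)|].
  apply: contrapT => nss; apply: fc; exists d => // s s' s0 s'0 s's.
  rewrite leNgt; apply/negP => H; apply: nss; exists s, s'; split=> //.
exists [set g : T | c * `|s' - s| < `|g s' - g s - (s' - s) *: F (g s)|].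
exists K; split.
- set gap := `|f s' - f s - (s' - s) *: F (f s)| - c * `|s' - s|.
  have gap0 : 0 < gap by rewrite subr_gt0.
  have g3 : 0 < gap / 3 by rewrite divr_gt0.
  have w0 : 0 < `|s' - s| + 1 by rewrite ltr_wpDl.
  have g4 : 0 < gap / 3 / (`|s' - s| + 1) by rewrite divr_gt0.
  have A1 := projc s' f _ (nbhs_norm_lt (f s') g3).
  have A2 := projc s f _ (nbhs_norm_lt (f s) g3).
  have A3 := projc s f _ (Fc (f s) _ (nbhs_norm_lt (F (f s)) g4)).
  have FF := @nbhs_filter T f.
  have A123 := @filterI T _ FF _ _ A1 (@filterI T _ FF _ _ A2 A3).
  apply: (@filterS T _ FF _ _ _ A123) => g /= [gs' [gs Fgs]].
  have {}Fgs : `|(s' - s) *: (F (g s) - F (f s))| < gap / 3.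
    rewrite normrZ; apply: le_lt_trans (_ : (`|s' - s| + 1) * `|F (g s) - F (f s)| < _).
      by rewrite ler_wpM2r// lerDl.
    by rewrite mulrC -ltr_pdivlMr.
  rewrite -subr_gt0 -[X in _ < X]/(_ - _).
  have : `|f s' - f s - (s' - s) *: F (f s)| <= `|g s' - g s - (s' - s) *: F (g s)| +
      (`|g s' - f s'| + `|g s - f s| + `|(s' - s) *: (F (g s) - F (f s))|).
    rewrite [X in _ + (X + _ + _)]distrC.
    rewrite (_ : f s' - f s - _ = g s' - g s - (s' - s) *: F (g s) +
      (f s' - g s' + (g s - f s) + (s' - s) *: (F (g s) - F (f s)))).
      rewrite (le_trans (ler_normD _ _))// lerD2l.
      by rewrite (le_trans (ler_normD _ _))// lerD2r ler_normD.
    rewrite scalerBr; apply/rowP => i; rewrite !mxE; lra.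
  by move: gs' gs Fgs; rewrite /gap; lra.
- exact: withinT.
move=> g x' _ /= + Kx' gx'; rewrite gx' /psi (ger0_norm s0) (ger0_norm s'0) => H.
have [sol _] := phiP _ Kx'; have := dP _ _ sol _ _ s0 s'0 s's.
by rewrite leNgt H.
Qed.

Lemma is_derive_quotientP (R : realType) (V : normedModType R) (x : R -> V) (t : R) l :
  is_derive t 1 x l <-> h^-1 *: (x (h + t) - x t) @[h --> 0^'] --> l.
Proof.
have E : (fun h : R => h^-1 *: ((x \o shift t) (h *: 1) - x t)) =
         (fun h => h^-1 *: (x (h + t) - x t)).
  by apply/funext => h /=; rewrite [h *: 1]mulr1.
split=> [xl|xl]; first by rewrite -E -[l]derive_val; exact: ex_derive.
rewrite -E in xl; apply: DeriveDef; last exact: cvg_lim xl.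
by apply/cvg_ex; exists l.
Qed.

Lemma solution_shift (R : realType) n (D : set 'rV[R]_n) F x0 x s :
  solution D F x0 x -> 0 <= s -> solution D F (x s) (fun t => x (s + t)).
Proof.
move=> xs; rewrite le_eqVlt => /orP[/eqP <-|s0].
  have [x00 ? ? ?] := xs; rewrite x00 (_ : (fun t => _) = x)//.
  by apply/funext => t; rewrite add0r.
have [_ xD _ xd] := xs; split.
- by rewrite addr0.
- by move=> t t0; apply: xD; rewrite addr_ge0// ltW.
- rewrite addr0 (_ : (fun h => _) = (fun h => h^-1 *: (x (h + s) - x s))).
    by have /is_derive_quotientP/cvg_dnbhs_at_right := xd _ s0.
  by apply/funext => h; rewrite [s + h]addrC.
- move=> t t0; have /is_derive_quotientP H := xd _ (addr_gt0 s0 t0).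
  apply/is_derive_quotientP.
  rewrite (_ : (fun h => _) = (fun h => h^-1 *: (x (h + (s + t)) - x (s + t))))//.
  by apply/funext => h; rewrite addrCA.
Qed.

(** * Radial retraction onto a ball *)

Definition radial (R : realType) n (r : R) (x : 'rV[R]_n) : 'rV[R]_n :=
  (r / Num.max r `|x|) *: x.

Lemma max_norm_continuous (R : realType) n (r : R) :
  continuous (fun x : 'rV[R]_n => Num.max r `|x|).
Proof.
move=> x; apply/continuous_epsP => e e0; exists e => // y.
have := ler_dist_dist y x.
by case: (leP r `|x|); case: (leP r `|y|); rewrite !ltr_norml !ler_norml;
  move=> ? ? /andP[? ?] ?; apply/andP; split; lra.
Qed.

Lemma radial_continuous (R : realType) n (r : R) : 0 < r ->
  continuous (@radial R n r).
Proof.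
move=> r0 x; have m0 : 0 < Num.max r `|x| by rewrite lt_max r0.
have mc := @max_norm_continuous R n r x.
have c1 : {for x, continuous (fun y : 'rV[R]_n => (Num.max r `|y|)^-1)}.
  by apply: continuousV => //; rewrite gt_eqF.
have c2 : {for x, continuous (fun y : 'rV[R]_n => r / (Num.max r `|y|))}.
  by apply: continuousM => //; exact: cst_continuous.
exact: (continuousZ c2 (@cvg_id _ (nbhs x))).
Qed.

Lemma radial_id (R : realType) n (r : R) (x : 'rV[R]_n) : 0 < r ->
  `|x| <= r -> radial r x = x.
Proof. by move=> r0 xr; rewrite /radial max_l// divff ?scale1r// gt_eqF. Qed.

Lemma radial_out (R : realType) n (r : R) (x : 'rV[R]_n) :
  r <= `|x| -> radial r x = (r / `|x|) *: x.
Proof. by move=> rx; rewrite /radial max_r. Qed.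

Lemma radial_norm (R : realType) n (r : R) (x : 'rV[R]_n) : 0 < r ->
  r <= `|x| -> `|radial r x| = r.
Proof.
move=> r0 rx; have x0 := lt_le_trans r0 rx.
by rewrite radial_out// normrZ ger0_norm ?divfK ?gt_eqF// divr_ge0 ?ltW.
Qed.

Lemma radial_cball (R : realType) n (r : R) (x : 'rV[R]_n) : 0 < r ->
  cball r (radial r x).
Proof.
move=> r0; rewrite /cball/=; have [xr|/ltW rx] := leP `|x| r.
  by rewrite radial_id.
by rewrite radial_norm.
Qed.

Lemma continuous_comp_within (S T U : topologicalType) (D : set T)
    (p : S -> T) (f : T -> U) :
  {within D, continuous f} -> continuous p -> (forall x, D (p x)) ->
  continuous (f \o p).
Proof.
move=> fc pc pD x A Afx.
have W : within D (nbhs (p x)) (f @^-1` A).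
  by rewrite nbhs_subspace_in//; exact: fc.
by apply: (@filterS _ _ (nbhs_filter x) _ _ _ (pc x _ W)) => y /=; apply; exact: pD.
Qed.

(** * From the vector field to the displacement of the flow *)

Section Brockett.
Variables (R : realType) (n : nat) (F : 'rV[R]_n -> 'rV[R]_n) (e r : R).
Variable phi : 'rV[R]_n -> R -> 'rV[R]_n.
Hypothesis r0 : 0 < r.
Hypothesis Fc : continuous F.
Hypothesis phiP : flow_on (cball e) F (cball r) phi.
Hypothesis attr : forall x, cball r x -> phi x t @[t --> +oo] --> (0 : 'rV[R]_n).

Lemma flow0 x : cball r x -> phi x 0 = x.
Proof. by move=> /phiP[[]]. Qed.

(** A point to which its trajectory returns at arbitrarily large times is the
    limit of this trajectory, that is, 0. *)
Lemma recurrent_eq0 x t : cball r x -> 0 < t ->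
  (forall k, phi x (k%:R * t) = x) -> x = 0.
Proof.
move=> xr t0 per; apply/eqP; rewrite -normr_eq0 eq_sym.
have := normr_ge0 x; rewrite le_eqVlt => /orP[//|x0].
have /cvgrPdist_lt/(_ _ x0)[M [Mr MP]] := attr xr.
have [k Mk] : exists k, M < k%:R * t.
  exists (Num.truncn (M / t)).+1; rewrite -ltr_pdivrMr//; exact: truncnS_gt.
by have := MP _ Mk; rewrite per sub0r normrN ltxx.
Qed.

Lemma periodic_eq0 x t : cball r x -> 0 < t -> phi x t = x -> x = 0.
Proof.
move=> xr t0 pt; apply: (recurrent_eq0 xr t0).
have [xs xu] := phiP xr.
have sh := solution_shift xs (ltW t0); rewrite pt in sh.
elim=> [|k IH]; first by rewrite mul0r flow0.
have kt0 : 0 <= k%:R * t by rewrite mulr_ge0// ltW.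
by rewrite -[RHS]IH -(xu _ sh _ kt0) mulrSr mulrDl mul1r addrC.
Qed.

Lemma equilibrium_eq0 x : cball r x -> F x = 0 -> x = 0.
Proof.
move=> xr Fx; apply: (recurrent_eq0 xr ltr01) => k.
have [xs xu] := phiP xr.
suff H : solution (cball e) F x (fun=> x) by rewrite -(xu _ H)// mulr1.
have [x00 xe _ _] := xs; split=> //.
- by move=> _ _; rewrite -[x in cball _ x]x00; exact: xe.
- by rewrite Fx subrr; under eq_fun do rewrite scaler0; exact: cvg_cst.
- by move=> t _; rewrite Fx; exact: is_derive_cst.
Qed.

(** Each trajectory enters the ball of radius d, and so do the nearby ones at
    the same time, by continuous dependence; stability then keeps them in the
    ball of radius r / 2, and compactness makes the time uniform. *)
Lemma uniform_time :
  (exists2 d, 0 < d & forall x y, `|x| < d -> solution (cball e) F x y ->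
     forall t, 0 <= t -> `|y t| < r / 2) ->
  exists2 T, 0 < T & forall x, cball r x -> `|phi x T| < r / 2.
Proof.
move=> [d d0 dP].
suff H : \forall T \near +oo, forall x, cball r x -> `|phi x T| < r / 2.
  have [T [T0 TP]] :=
    filter_ex (filterI (nbhs_pinfty_gt (num_real (0 : R))) H).
  by exists T.
apply: compact_near_uniform; first exact: cball_compact.
move=> x xr.
have /cvgrPdist_lt/(_ _ d0) H := attr xr.
have [t0 [t00]] := filter_ex (filterI (nbhs_pinfty_gt (num_real (0 : R))) H).
rewrite /= sub0r normrN -subr_gt0 => td.
have [c c0 cP] := flow_dependence Fc phiP xr (ltW t00) td.
exists [set x' | `|x' - x| < c], [set t | t0 <= t]; split.
- exact: nbhs_norm_lt.
- by apply: nbhs_pinfty_ge; exact: num_real.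
move=> x' t x'r /= x'x t0t; have [xs' xu'] := phiP x'r.
have x't0 : `|phi x' t0| < d.
  have := cP _ x'r x'x; have := ler_normD (phi x' t0 - phi x t0) (phi x t0).
  by rewrite subrK; lra.
have := dP _ _ x't0 (solution_shift xs' (ltW t00)) (t - t0).
by rewrite /= [t0 + _]addrC subrK; apply; rewrite subr_ge0.
Qed.

Variable T : R.
Hypothesis T0 : 0 < T.
Hypothesis TP : forall x, cball r x -> `|phi x T| < r / 2.

(** Grows linearly with |z| from 0 on the inner ball to T at |z| = 2 r. *)
Definition travel_time (z : 'rV[R]_n) := T / r * (Num.max r `|z| - r).
(** The homotopy from F to the displacement of the flow at time T, laid out
    along the radius. *)
Definition chord (z : 'rV[R]_n) : 'rV[R]_n :=
  if `|z| <= r then F (radial r z)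
  else (travel_time z)^-1 *: (phi (radial r z) (travel_time z) - radial r z).

Lemma travel_time_ge0 z : 0 <= travel_time z.
Proof.
by apply: mulr_ge0; [rewrite divr_ge0 ?ltW|rewrite subr_ge0 le_max lexx].
Qed.

Lemma travel_time_gt0 z : r < `|z| -> 0 < travel_time z.
Proof.
move=> rz; apply: mulr_gt0; first by rewrite divr_gt0.
by rewrite subr_gt0 lt_max rz orbT.
Qed.

Lemma travel_time_eq0 z : `|z| <= r -> travel_time z = 0.
Proof. by move=> rz; rewrite /travel_time max_l// subrr mulr0. Qed.

Lemma travel_time_continuous : continuous travel_time.
Proof.
move=> z.
have mc : {for z, continuous (fun y : 'rV[R]_n => Num.max r `|y| - r)}.
  by apply: continuousB; [exact: max_norm_continuous|exact: cst_continuous].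
exact: (continuousM (@cst_continuous _ _ (T / r) z) mc).
Qed.

(** On the sphere |z| = r the two formulas match because a short chord of a
    solution is close to F, uniformly in the solution ([solution_estimate]).
    Outside, the flow is jointly continuous: it depends continuously on the
    initial state and is Lipschitz in time. *)
Lemma chord_continuous : continuous chord.
Proof.
move=> z.
have rc := @radial_continuous R n r r0.
have rb (x : 'rV[R]_n) : cball r (radial r x) := radial_cball x r0.
have [zr|rz] := leP `|z| r.
  apply/continuous_epsP => c c0.
  have c2 : 0 < c / 2 by rewrite divr_gt0.
  have [d d0 dP] := solution_estimate e Fc c2.
  have [d1 d10 d1P] := (continuous_epsP _ z).1 (@travel_time_continuous z) d d0.
  have [|d2 d20 d2P] := (continuous_epsP (F \o radial r) z).1 _ _ c2.
    by apply: continuous_comp; [exact: rc|exact: Fc].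
  exists (Num.min d1 d2); first by rewrite lt_min d10.
  move=> y; rewrite lt_min => /andP[/d1P yd1 /d2P /= yd2].
  rewrite {2}/chord zr -(subrKA (F (radial r y))) (le_lt_trans (ler_normD _ _))//.
  rewrite [c]splitr ler_ltD// /chord.
  case: ifPn => [yr|]; first by rewrite subrr normr0 ltW.
  rewrite -ltNge => /travel_time_gt0 ty0.
  have [ys _] := phiP (rb y).
  have := dP _ _ ys 0 (travel_time y) (lexx _) (ltW ty0).
  move: yd1; rewrite (travel_time_eq0 zr) => yd1 /(_ yd1); rewrite !subr0.
  rewrite (flow0 (rb y)) mulrC -ler_pdivrMl ?normr_gt0 ?gt_eqF//.
  rewrite -normfV -normrZ [in leLHS]scalerBr scalerA mulVf ?scale1r// gt_eqF//.
have tz0 := travel_time_gt0 rz.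
pose q y := (travel_time y)^-1 *: (phi (radial r y) (travel_time y) - radial r y).
have chordE y : r < `|y| -> chord y = q y by rewrite /chord ltNge => /negPf ->.
have pc : {for z, continuous (fun y => phi (radial r y) (travel_time y))}.
  apply/continuous_epsP => c c0; have c2 : 0 < c / 2 by rewrite divr_gt0.
  have [M M0 MP] := solution_lipschitz e Fc.
  have [d d0 dP] := flow_dependence Fc phiP (rb z) (ltW tz0) c2.
  have [d1 d10 d1P] := (continuous_epsP _ z).1 (rc z) d d0.
  have cM : 0 < c / 2 / M by rewrite divr_gt0.
  have [d2 d20 d2P] := (continuous_epsP _ z).1 (@travel_time_continuous z) _ cM.
  exists (Num.min d1 d2); first by rewrite lt_min d10.
  move=> y; rewrite lt_min => /andP[/d1P yd1 /d2P /= yd2].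
  rewrite -(subrKA (phi (radial r y) (travel_time z))) (le_lt_trans (ler_normD _ _))//.
  rewrite [c]splitr ltrD//; last exact: dP.
  have [ys _] := phiP (rb y).
  apply: (le_lt_trans (MP _ _ ys _ _ (ltW tz0) (travel_time_ge0 y))).
  by rewrite mulrC -ltr_pdivlMr.
have qc : {for z, continuous q}.
  apply: continuousZ; last by apply: continuousB; [exact: pc|exact: rc].
  by apply: continuousV; [rewrite gt_eqF|exact: travel_time_continuous].
apply/continuous_epsP => c c0.
have [d d0 dP] := (continuous_epsP q z).1 qc c c0.
exists (Num.min d (`|z| - r)); first by rewrite lt_min d0 subr_gt0.
move=> y; rewrite lt_min => /andP[/dP yd yz]; rewrite !chordE//.
by have := ler_dist_dist y z; move: yz; rewrite distrC ler_norml => ? /andP[]; lra.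
Qed.

Lemma chord_neq0 z : r <= `|z| -> chord z != 0.
Proof.
move=> rz; have rb := radial_cball z r0; have rn := radial_norm r0 rz.
have rad0 : radial r z != 0 by rewrite -normr_eq0 rn gt_eqF.
rewrite /chord; case: ifPn => [_|zr]; apply: contra rad0.
  by move=> /eqP/(equilibrium_eq0 rb) ->.
have tz0 : 0 < travel_time z by apply: travel_time_gt0; rewrite ltNge.
rewrite scaler_eq0 invr_eq0 gt_eqF//= subr_eq0 => /eqP.
by move=> /(periodic_eq0 rb tz0) ->.
Qed.

Lemma chord_bounded_below : exists2 c, 0 < c &
  forall z, cball (2 * r) z -> r <= `|z| -> c <= `|chord z|.
Proof.
suff H : \forall c \near (0 : R)^'+, forall z, cball (2 * r) z ->
    r <= `|z| -> c <= `|chord z|.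
  have [c [c0 cP]] := filter_ex (filterI (nbhs_right_gt (0 : R)) H).
  by exists c.
apply: compact_near_uniform; first exact: cball_compact.
move=> z _; have [zr|rz] := ltP `|z| r.
  exists [set y | `|y| < r], setT; split.
  - exact: (cvgr_lt `|z| (@norm_continuous _ _ z) _ zr).
  - exact: filterT.
  - by move=> y c _ /= yr _; rewrite leNgt yr.
have Hz : 0 < `|chord z| / 2 by rewrite divr_gt0// normr_gt0 chord_neq0.
have [d d0 dP] := (continuous_epsP _ z).1 (@chord_continuous z) _ Hz.
exists [set y | `|y - z| < d], [set c | c < `|chord z| / 2]; split.
- exact: nbhs_norm_lt.
- exact: nbhs_right_lt.
move=> y c _ /= /dP yz cz _.
have := ler_distD (chord y) (chord z) 0.
by rewrite !subr0 [`|chord z - _|]distrC; lra.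
Qed.

Lemma flow_covers : exists2 c, 0 < c &
  forall y, `|y| < c -> exists2 x, cball r x & F x = y.
Proof.
have [c c0 cP] := chord_bounded_below.
have q0 : 0 < r / (2 * T) by rewrite divr_gt0// mulr_gt0.
exists (Num.min c (r / (2 * T))); first by rewrite lt_min c0.
move=> y; rewrite lt_min => /andP[yc yq].
have r20 : 0 < 2 * r by rewrite mulr_gt0.

(* At |z| = 2 r the base point is z / 2 and the duration is T, so in a
   coordinate i with z i = s * 2 r the displacement is s r up to r / 2, in the
   direction opposite to s; the bound on y absorbs the rest. *)
have bd z i (s : R) : cball (2 * r) z -> `|s| = 1 -> z ord0 i = s * (2 * r) ->
    s * (y ord0 i - chord z ord0 i) >= 0.
  move=> zr s1 zi.
  have zn : `|z| = 2 * r.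
    apply/eqP; rewrite eq_le; apply/andP; split; first exact: zr.
    by apply: le_trans (rV_norm_coord z i); rewrite zi normrM s1 mul1r ger0_norm// ltW.
  have rz : r < `|z| by rewrite zn; lra.
  have tz : travel_time z = T.
    by rewrite /travel_time max_r ?ltW// zn; field; rewrite gt_eqF.
  have radz : radial r z ord0 i = s * r.
    by rewrite (radial_out (ltW rz)) zn mxE zi; field; rewrite gt_eqF.
  have : `|phi (radial r z) T| < r / 2 by apply: TP; exact: radial_cball.
  rewrite /chord ifN -?ltNge// tz; move: (phi _ _) => p pr.
  move: (radial r z) radz => q qi; rewrite !mxE qi; set Ti := T^-1.
  have Ti0 : 0 < Ti by rewrite invr_gt0.
  have ss : s * s = 1 by rewrite -expr2 -real_normK ?num_real// s1 expr1n.
  have ys : `|s * y ord0 i| < Ti * (r / 2).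
    rewrite normrM s1 mul1r (le_lt_trans (rV_norm_coord y i))//.
    have -> : Ti * (r / 2) = r / (2 * T) by rewrite /Ti; field; rewrite gt_eqF.
    exact: yq.
  have ps : `|s * p ord0 i| < r / 2.
    by rewrite normrM s1 mul1r (le_lt_trans (rV_norm_coord p i)).
  have -> : s * (y ord0 i - Ti * (p ord0 i - s * r)) =
      s * y ord0 i - Ti * (s * p ord0 i) + Ti * r * (s * s) by ring.
  have : Ti * (s * p ord0 i) < Ti * (r / 2).
    by rewrite ltr_pM2l//; move: ps; rewrite ltr_norml => /andP[].
  move: ys; rewrite ss ltr_norml => /andP[ys _] ps'.
  by rewrite mulr1; lra.
have [z [z2r gz]] : exists z, cball (2 * r) z /\ y - chord z = 0.
  apply: (@poincare_miranda R n (2 * r) (fun z => y - chord z)) => //.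
  - by move=> z; apply: continuousB; [exact: cst_continuous|exact: chord_continuous].
  - move=> x i xr xi; have := bd x i (-1) xr; rewrite normrN normr1 mulN1r xi !mxE.
    by move=> /(_ erefl erefl); lra.
  - move=> x i xr xi; have := bd x i 1 xr; rewrite normr1 mul1r xi !mxE.
    by move=> /(_ erefl erefl); lra.
have yz : chord z = y by apply/esym/eqP; rewrite -subr_eq0 gz.
have [rz|zr] := leP r `|z|.
  by have := cP _ z2r rz; rewrite yz leNgt yc.
exists z; first exact: ltW.
by rewrite -yz /chord ltW// radial_id ?ltW.
Qed.
End Brockett.

(** * Brockett's condition *)

Lemma solution_congr (R : realType) n (D D' : set 'rV[R]_n) F F' x0 x :
  solution D F x0 x -> (forall t, 0 <= t -> D' (x t) /\ F' (x t) = F (x t)) ->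
  solution D' F' x0 x.
Proof.
move=> [x00 _ x0' x'] xE; split=> //.
- by move=> t /xE[].
- by rewrite (xE 0 (lexx _)).2.
- by move=> t t0; rewrite (xE t (ltW t0)).2; exact: x'.
Qed.

Lemma nbhs0_cball (R : realType) n (A : set 'rV[R]_n) :
  nbhs (0 : 'rV[R]_n) A -> exists2 r, 0 < r & cball r `<=` A.
Proof.
move=> /nbhs_ballP[d /= d0 dA]; exists (d / 2); first by rewrite divr_gt0.
move=> x xd; apply: dA; rewrite -ball_normE/= sub0r normrN.
by rewrite (le_lt_trans xd)// ltr_pdivrMr// ltr_pMr// ltr1n.
Qed.

(** Composing F with the radial retraction gives a field defined everywhere that
    has, in a small ball, the same solutions as F. *)
Theorem brockett (R : realType) n (D : set 'rV[R]_n) F :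
  nbhs (0 : 'rV[R]_n) D -> uniqueness_criterion D F ->
  locally_asymptotically_stable D F -> open_at D F 0.
Proof.
move=> D0 [Fc Funiq] [F0 Fstab [da da0 Fattr]] V V0.
have [e e0 eD] := nbhs0_cball D0.
have [ds ds0 dsP] := Fstab e e0.
have [r1 r10 r1P] := nbhs0_cball (filterI V0 Funiq).
have [r [r0 re rr1 rds rda]] : exists r, [/\ 0 < r, r <= e, r <= r1, r < ds & r < da].
  exists (Num.min (Num.min e r1) (Num.min (ds / 2) (da / 2))).
  rewrite !lt_min e0 r10 !divr_gt0//=; split=> //.
  - by rewrite !ge_min lexx.
  - by rewrite !ge_min lexx orbT.
  - by rewrite !gt_min (_ : ds / 2 < ds) ?orbT//; lra.
  - by rewrite !gt_min (_ : da / 2 < da) ?orbT//; lra.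
pose G := F \o radial e.
have Gc : continuous G.
  apply: continuous_comp_within Fc _ _; first exact: radial_continuous.
  move=> x.
  by apply: eD; exact: radial_cball.
have GE x : cball e x -> G x = F x by move=> xe; rewrite /G/= radial_id.
have toG x0 x : `|x0| < ds -> solution D F x0 x -> solution (cball e) G x0 x.
  move=> x0d xs; apply: (solution_congr xs) => t t0.
  have xe : cball e (x t) by apply: ltW; exact: dsP xs _ t0.
  by rewrite GE.
have toF x0 x : solution (cball e) G x0 x -> solution D F x0 x.
  move=> xs; apply: (solution_congr xs) => t t0; have [_ xe _ _] := xs.
  by split; [exact: eD (xe _ t0)|rewrite GE//; exact: xe].
have small x : cball r x -> `|x| < ds by move=> xr; exact: le_lt_trans rds.
have ex x : exists y, cball r x -> solution (cball e) G x y.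
  have [xr|xr] := pselect (cball r x); last by exists (fun=> 0).
  have [_ [[y ys] _]] := r1P x (le_trans xr rr1).
  by exists y => _; apply: toG ys; exact: small.
have [phi phiP] := choice ex.
have flow : flow_on (cball e) G (cball r) phi.
  move=> x xr; split; first exact: phiP.
  move=> y ys t t0; have [_ [_ u]] := r1P x (le_trans xr rr1).
  by apply: u => //; apply: toF => //; exact: phiP.
have attr x : cball r x -> phi x t @[t --> +oo] --> (0 : 'rV[R]_n).
  move=> xr; apply: (Fattr x); first exact: le_lt_trans rda.
  by apply: toF; exact: phiP.
have [T T0 TP] : exists2 T, 0 < T & forall x, cball r x -> `|phi x T| < r / 2.
  apply: (uniform_time Gc flow attr).
  have [|d d0 dP] := Fstab (r / 2); first by rewrite divr_gt0.
  exists d => // x y xd ys; exact: dP xd (toF _ _ ys).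
have [c c0 cP] := flow_covers r0 Gc flow attr T0 TP.
rewrite F0; apply/nbhs_ballP; exists c => // y; rewrite -ball_normE/= sub0r normrN.
move=> /cP[x xr <-]; have xe : cball e x := le_trans xr re.
exists x; last by rewrite GE.
by split; [have [] := r1P x (le_trans xr rr1)|exact: eD].
Qed.

Theorem theorem4p8 (R : realType) (n m : nat)
    (X : set 'rV[R]_n) (U : set 'rV[R]_m)
    (f : 'rV[R]_n * 'rV[R]_m -> 'rV[R]_n)
    (hXU : nbhs ((0, 0) : 'rV[R]_n * 'rV[R]_m) (X `*` U))
    (hf : {within X `*` U, continuous f})
    (hf0 : f (0, 0) = 0)
    (hstab : stabilizable_by_continuous_symbol X U f) :
  open_at (X `*` U) f (0, 0).
Proof.
have [D [h [[D0 _ hXUD] h0 hc hu hs]]] := hstab.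
move=> V V0.
have : nbhs (0 : 'rV[R]_n) (D `&` [set x | D x -> V (h x)]).
  apply: filterI => //.
  have : within D (nbhs (0 : 'rV[R]_n)) (h @^-1` V).
    rewrite nbhs_subspace_in; last exact: nbhs_singleton.
    by move: V0; rewrite -h0; exact: hc.
  by [].
move=> /(brockett D0 hu hs); rewrite /composition_operator/= h0.
apply: filterS => _ [x [[_ xV] Dx] <-].
by exists (h x) => //; split; [exact: xV|exact: hXUD].
Qed.
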